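(* Let $R$ be an associative ring with identity, and let $\mathbf{K}^{\mathcal{F}}$ denote the class of flat left $R$-modules with pure embeddings. Assume $\lambda\geq (|R| + \aleph_0)^+$. If $M$ is a $(\lambda, \alpha)$-limit model in $\mathbf{K}^{\mathcal{F}}$ and $\operatorname{cf}(\alpha)\geq (|R| + \aleph_0)^+$, then $M$ is a cotorsion module.
   Context: $\mathbf{K}^{\mathcal{F}} = (K_{flat}, \leq_{pp})$, where $K_{flat}$ is the class of flat left $R$-modules and $\leq_{pp}$ is the pure submodule relation. $\mathbf{K}^{\mathcal{F}}_{\lambda}$ is the class of flat left $R$-modules of cardinality $\lambda$, and $\mathbf{K}^{\mathcal F}_{\leq\lambda}$ those of cardinality at most $\lambda$. A pure embedding $f: M \to N$ is an isomorphism from $M$ onto a pure submodule of $N$. For $N \leq_{pp} M$ in $\mathbf{K}^{\mathcal{F}}$, $M$ is universal over $N$ if $|M| = |N|=\lambda$ (cardinalities) and for every $N^* \in \mathbf{K}^{\mathcal{F}}_{\leq \lambda}$ with $N \leq_{pp} N^*$ there is a pure embedding $f: N^* \to M$ fixing $N$ pointwise. Let $\lambda$ be an infinite cardinal and $\alpha < \lambda^+$ a limit ordinal. $M$ is a $(\lambda,\alpha)$-limit model if there is a $\leq_{pp}$-increasing continuous chain $\{M_i : i < \alpha\} \subseteq \mathbf{K}^{\mathcal{F}}_\lambda$ (continuous: unions at limit stages) such that $M_{i+1}$ is universal over $M_i$ for each $i<\alpha$, and $M = \bigcup_{i<\alpha} M_i$. A left $R$-module $M$ is cotorsion if $\operatorname{Ext}^1(F,M)=0$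 for every flat left $R$-module $F$. *)

(* Defs.v *)
From HB Require Import structures.
From mathcomp Require Import all_boot all_order all_algebra.
From mathcomp Require Import boolp classical_sets functions cardinality wochoice.

Set Implicit Arguments.
Unset Strict Implicit.
Unset Printing Implicit Defensive.

Import Order.TTheory GRing.Theory.

Local Open Scope classical_set_scope.
Local Open Scope ring_scope.
Local Open Scope card_scope.

(* A cardinal is represented by a type having that many elements.  Giving the
   sort a name puts all these types in one universe, so that the minimality
   clause of card_succ ranges over every cardinal in use. *)
Definition cardinal := Type.

Definition card_lt (S T : cardinal) : Prop :=
  ([set: S] #<= [set: T]) /\ ~ ([set: T] #<= [set: S]).

(* T has cardinality |S|^+ *)
Definition card_succ (S T : cardinal) : Prop :=
  card_lt S T /\ forall U : cardinal, card_lt S U -> [set: T] #<= [set: U].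

(* An ordinal is represented by a well-ordered type of that order type. *)
Section Ordinals.
Context {d : Order.disp_t} (alpha : orderType d).

Definition limit_ordinal : Prop :=
  [/\ well_order (<=%O : rel alpha),
      exists i : alpha, True
    & forall i : alpha, exists j, (i < j)%O].

Definition is_succ (i j : alpha) : Prop :=
  (i < j)%O /\ forall k, (i < k)%O -> (j <= k)%O.

Definition is_limit (j : alpha) : Prop :=
  (exists i, (i < j)%O) /\ forall i, ~ is_succ i j.

Definition cofinal (X : set alpha) : Prop :=
  forall i, exists2 j, X j & (i <= j)%O.

(* C has cardinality cf(alpha) *)
Definition cofinality (C : cardinal) : Prop :=
  (exists2 X : set alpha, cofinal X & X #= [set: C]) /\
  forall X : set alpha, cofinal X -> [set: C] #<= X.

(* alpha < lambda^+, lambda^+ being an initial ordinal *)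
Definition lt_card_succ (lambda : cardinal) : Prop :=
  exists2 mu : cardinal, card_succ lambda mu & card_lt alpha mu.

End Ordinals.

Record submodule (R : pzRingType) (M : lmodType R) (S : submodClosed M) :=
  Submodule { submodule_val :> M; submodule_valP : submodule_val \in S }.

HB.instance Definition _ (R : pzRingType) (M : lmodType R)
  (S : submodClosed M) := [isSub for @submodule_val R M S].
HB.instance Definition _ (R : pzRingType) (M : lmodType R)
  (S : submodClosed M) := [Choice of submodule S by <:].
HB.instance Definition _ (R : pzRingType) (M : lmodType R)
  (S : submodClosed M) := [SubChoice_isSubLmodule of submodule S by <:].

(* Right R-modules are left modules over the converse ring R^c: if A is a
   right module then (r : R^c) *: a stands for a r. *)

(* The tensor product of A and M over R, as a setoid: the list
   [:: (a1, x1); ..; (an, xn)] stands for the sum of the a_i (x) x_i, and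
   tensor_eq is equality in the tensor product.  The quotient is a group since
   (- a, x) is opposite to (a, x). *)
Inductive tensor_eq (R : pzRingType) (A : lmodType R^c) (M : lmodType R) :
    seq (A * M) -> seq (A * M) -> Prop :=
| tensor_refl s : tensor_eq s s
| tensor_sym s t : tensor_eq s t -> tensor_eq t s
| tensor_trans s t u : tensor_eq s t -> tensor_eq t u -> tensor_eq s u
| tensor_cat s s' t t' :
    tensor_eq s s' -> tensor_eq t t' -> tensor_eq (s ++ t) (s' ++ t')
| tensor_catC s t : tensor_eq (s ++ t) (t ++ s)
| tensor_0l x : tensor_eq [:: (0, x)] [::]
| tensor_Dl a b x : tensor_eq [:: (a + b, x)] [:: (a, x); (b, x)]
| tensor_Dr a x y : tensor_eq [:: (a, x + y)] [:: (a, x); (a, y)]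
| tensor_balanced (r : R) a x :
    tensor_eq [:: ((r : R^c) *: a, x)] [:: (a, r *: x)].

Definition tensor_map (R : pzRingType) (A B : lmodType R^c) (M : lmodType R)
    (f : {linear A -> B}) (s : seq (A * M)) : seq (B * M) :=
  [seq (f p.1, p.2) | p <- s].

(* The functor - (x) M preserves injectivity; it is always right exact. *)
Definition flat (R : pzRingType) (M : lmodType R) : Prop :=
  forall (A B : lmodType R^c) (f : {linear A -> B}), injective f ->
  forall s t : seq (A * M),
    tensor_eq (tensor_map f s) (tensor_map f t) -> tensor_eq s t.

(* The pp-formula exists y, (pp_free x + pp_bound y = 0) in n free
   variables x. *)
Record pp_formula (R : pzRingType) (n : nat) := PPFormula {
  pp_neqs : nat;
  pp_nbound : nat;
  pp_free : 'M[R]_(pp_neqs, n);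
  pp_bound : 'M[R]_(pp_neqs, pp_nbound) }.

Definition pp_sat (R : pzRingType) (M : lmodType R) (S : set M) (n : nat)
    (phi : pp_formula R n) (x : 'I_n -> M) : Prop :=
  exists2 y : 'I_(pp_nbound phi) -> M, forall k, S (y k) &
  forall i : 'I_(pp_neqs phi),
    \sum_j pp_free phi i j *: x j + \sum_k pp_bound phi i k *: y k = 0.

(* S <=_pp T, for submodules S and T of M *)
Definition pure_sub (R : pzRingType) (M : lmodType R) (S T : set M) : Prop :=
  S `<=` T /\
  forall (n : nat) (phi : pp_formula R n) (x : 'I_n -> M),
    (forall i, S (x i)) -> pp_sat T phi x -> pp_sat S phi x.

Definition pure_embedding (R : pzRingType) (M N : lmodType R)
    (f : {linear M -> N}) : Prop :=
  injective f /\ pure_sub (range f) setT.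

(* T is universal over S, for S <=_pp T inside an ambient module E; the
   extensions of S are given by pure embeddings g : S -> X. *)
Definition universal_over (R : pzRingType) (E : lmodType R)
    (S T : submodClosed E) : Prop :=
  [set: submodule T] #= [set: submodule S] /\
  forall (X : lmodType R) (g : {linear submodule S -> X}),
    flat X -> [set: X] #<= [set: submodule S] -> pure_embedding g ->
    exists2 f : {linear X -> submodule T}, pure_embedding f &
      forall x : submodule S, f (g x) = x :> E.

Definition limit_model (R : pzRingType) (lambda : cardinal)
    (d : Order.disp_t) (alpha : orderType d) (M : lmodType R) : Prop :=
  [/\ infinite_set [set: lambda],
      limit_ordinal alpha,
      lt_card_succ alpha lambda
    & exists C : alpha -> submodClosed M,
      [/\ forall i,
            flat (submodule (C i)) /\ [set: submodule (C i)] #= [set: lambda],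
          forall i j, (i < j)%O -> pure_sub [set` C i] [set` C j],
          forall j, is_limit j ->
            [set` C j] = \bigcup_(i in [set i | (i < j)%O]) [set` C i],
          forall i j, is_succ i j -> universal_over (C i) (C j)
        & \bigcup_i [set` C i] = [set: M]]].

Definition projective (R : pzRingType) (P : lmodType R) : Prop :=
  forall (X Y : lmodType R) (p : {linear X -> Y}), range p = setT ->
  forall f : {linear P -> Y}, exists g : {linear P -> X}, p \o g =1 f.

Record proj_resolution (R : pzRingType) (F : lmodType R) := ProjResolution {
  res_mod : nat -> lmodType R;
  res_d : forall n, {linear res_mod n.+1 -> res_mod n};
  res_aug : {linear res_mod 0 -> F};
  res_projective : forall n, projective (res_mod n);
  res_surj : range res_aug = setT;
  res_exact0 : range (res_d 0) = [set x | res_aug x = 0];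
  res_exactS : forall n, range (res_d n.+1) = [set x | res_d n x = 0] }.

(* Ext^1(F, N) = 0, i.e. H^1(Hom(P, N)) = 0 for P a projective resolution of
   F: every 1-cocycle is a coboundary. *)
Definition Ext1_eq0 (R : pzRingType) (F N : lmodType R) : Prop :=
  forall (P : proj_resolution F) (f : {linear res_mod P 1 -> N}),
    (forall x, f (res_d P 1 x) = 0) ->
    exists g : {linear res_mod P 0 -> N}, forall x, f x = g (res_d P 0 x).

Definition cotorsion (R : pzRingType) (M : lmodType R) : Prop :=
  forall F : lmodType R, flat F -> Ext1_eq0 F M.

(* Main.v *)
Require Import Defs.
From HB Require Import structures.
From mathcomp Require Import all_boot all_order all_algebra.
From mathcomp Require Import boolp classical_sets functions cardinality wochoice.

(** A limit model M is cotorsion because homomorphisms into it extend along every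
    inclusion K <= P with P / K flat.

    It suffices to extend h : K -> M to one more element p outside K, to a larger
    submodule that again has a flat cokernel; Zorn's lemma does the rest
    ([extend_linear]).  By closing p under solutions of linear equations modulo K
    one finds a submodule A of P, with p in A and |A| <= |R| + aleph_0, such that
    (K + A) / K and P / (K + A) are both flat ([small_flat_subquotient],
    [flat_quotient_add]).  As the cofinality of alpha exceeds |R| + aleph_0, the
    small set of values of h on A meeting K is contained in some M_i of the chain
    ([limit_absorbing]).  Form the pushout Q of A and M_i over that intersection.
    The cokernel of M_i -> Q is (K + A) / K, which is flat; hence M_i is pure in Q
    and Q is flat ([flat_quotient_pure], [flat_extension]).  Moreover
    |Q| <= lambda, by Hessenberg's theorem ([infinite_card_square]).  So the
    universality of M_(i+1) over M_i yields a map Q -> M_(i+1) that fixes M_i,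
    and the composite A -> Q -> M agrees with h on the intersection: together they
    define the extension of h to K + A ([extend_hom_graph]).

    For a flat module F with projective resolution P, Ext^1(F, M) = 0 is this
    extension property for the kernel K of P_0 -> F ([absorbing_cotorsion]).

    Flatness is used throughout in the form of the equational criterion, which is
    easily read modulo a submodule ([flat_quotient]).  Its equivalence with the
    definition by tensor products is [flat_equations] and [equations_flat]. *)

Set Implicit Arguments.
Unset Strict Implicit.
Unset Printing Implicit Defensive.

Import Order.TTheory GRing.Theory.

Local Open Scope classical_set_scope.
Local Open Scope card_scope.

(** * Cardinal arithmetic *)

(** [Zorn_bigcup] for extensions of a given set.  The empty chain, whose union
    need not satisfy P, is avoided by adding A0 to every member of a chain. *)
Lemma Zorn_bigcup_above (T : Type) (P : set (set T)) (A0 : set T) :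
    P A0 ->
    (forall F : set (set T), F A0 -> F `<=` P -> total_on F subset ->
      P (\bigcup_(X in F) X)) ->
  exists A, [/\ A0 `<=` A, P A & forall B, A `<=` B -> P B -> B `<=` A].
Proof.
move=> PA0 Pcup; pose Q A := P (A `|` A0).
have [F FQ totF|A [QA maxA]] := @Zorn_bigcup T Q.
  rewrite /Q; pose F' := [set X `|` A0 | X in F] `|` [set A0].
  have -> : \bigcup_(X in F) X `|` A0 = \bigcup_(X in F') X.
    apply/seteqP; split=> [x [[X FX Xx]|A0x]|x [_ [[X FX <-]|->]]].
    - by exists (X `|` A0); [left; exists X|left].
    - by exists A0; [right|].
    - by move=> [Xx|]; [left; exists X|right].
    - by right.
  apply: Pcup => [|_ [[X FX <-]|->] //|]; [by right|exact: FQ|].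
  move=> _ _ [[X FX <-]|->] [[Y FY <-]|->].
  - by have [XY|YX] := totF X Y FX FY; [left|right]; apply: setSU.
  - by right; apply: subsetUr.
  - by left; apply: subsetUr.
  - by left.
exists (A `|` A0); split=> // B AB PB.
apply: contrapT => nBA; apply: (maxA B).
  split=> [|BA]; first by apply: subset_trans AB; apply: subsetUl.
  by apply: nBA; apply: subset_trans BA _; apply: subsetUl.
rewrite /Q (_ : B `|` A0 = B) //; apply/setUidPl.
by apply: subset_trans AB; apply: subsetUr.
Qed.

Lemma card_leTP (T U : Type) :
  [set: T] #<= [set: U] <-> exists f : T -> U, injective f.
Proof.
split=> [|[f injf]]; last first.
  apply: inj_card_le; apply: unsquash; apply/injfunPex; exists f => //.
  by move=> x y _ _ /injf.
move=> /card_leP[f].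
have mT x : x \in [set: T] by rewrite inE.
exists (fun x => set_val (f (SigSub (mT x)))) => x y /val_inj fxy.
by have /(congr1 val) : SigSub (mT x) = SigSub (mT y)
  by apply: (@inj _ _ _ f) fxy; rewrite inE.
Qed.

(** A maximal partial injection between two types is total on one side. *)
Lemma card_le_total (T U : Type) :
  [set: T] #<= [set: U] \/ [set: U] #<= [set: T].
Proof.
pose P (G : set (T * U)) := forall p q, G p -> G q -> p.1 = q.1 <-> p.2 = q.2.
have [//|F _ FP totF p q [X FX Xp] [Y FY Yq]|G [_ PG maxG]] :=
  @Zorn_bigcup_above _ P set0.
  by have [XY|YX] := totF X Y FX FY; [apply: (FP Y FY) => //; apply: XY
    | apply: (FP X FX) => //; apply: YX].
have [domG|] := pselect (forall x, exists y, G (x, y)).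
  have [f fG] := choice domG; left; apply/card_leTP; exists f => x y fxy.
  exact/(PG _ _ (fG x) (fG y)).
move=> /existsNP[x /forallNP Gx].
have [ranG|] := pselect (forall y, exists x, G (x, y)).
  have [f fG] := choice ranG; right; apply/card_leTP; exists f => y z fyz.
  exact/(PG _ _ (fG y) (fG z)).
move=> /existsNP[y /forallNP Gy]; case: (Gx y).
apply: (maxG (G `|` [set (x, y)])); [exact: subsetUl| |by right].
move=> [a b] [a' b'] [Gab|[-> ->]] [Gab'|[-> ->]] //=.
- exact: (PG _ _ Gab Gab').
- by split=> e; subst; [case: (Gx b)|case: (Gy a)].
- by split=> e; subst; [case: (Gx b')|case: (Gy a')].
Qed.

(** Hessenberg's theorem.  Zorn's lemma gives a maximal graph G of an injection
    Y * Y -> Y, where Y contains a copy of [nat].  Graphs may be multivalued: what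
    counts is that distinct pairs have no value in common.  If the complement of Y were at
    least as large as Y, a copy f(Y) of Y inside it would provide fresh values
    for the pairs with a component in f(Y), against maximality.  Hence the
    complement embeds into Y, so T embeds into Y + Y, thus into Y * Y and Y. *)
Lemma infinite_card_square (T : Type) :
  [set: nat] #<= [set: T] -> [set: T * T] #<= [set: T].
Proof.
move=> /card_leTP[e inje].
(* The carrier Y is read off the diagonal of the graph. *)
pose car (G : set (T * T * T)) : set T := [set x | exists z, G (x, x, z)].
pose P G := [/\ forall x y, car G x -> car G y -> exists z, G (x, y, z),
  forall x y z, G (x, y, z) -> [/\ car G x, car G y & car G z] &
  forall x y x' y' z, G (x, y, z) -> G (x', y', z) -> x = x' /\ y = y'].
have [j injj] : exists j : nat * nat -> nat, injective j.
  by apply/card_leTP; move: card_nat2; rewrite card_eq_le => /andP[].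
pose G0 : set (T * T * T) := [set p | exists m n, p = (e m, e n, e (j (m, n)))].
have carG0 m : car G0 (e m) by exists (e (j (m, m))), m, m.
have PG0 : P G0.
  split.
  - move=> x y [_ [m [_ [-> _ _]]]] [_ [n [_ [-> _ _]]]].
    by exists (e (j (m, n))), m, n.
  - by move=> x y z [m [n [-> -> ->]]].
  - move=> x y x' y' z [m [n [-> -> ->]]] [m' [n' [-> ->]]].
    by move=> /inje/injj[-> ->].
have [F FG0 FP totF|G [G0G PG maxG]] := Zorn_bigcup_above PG0.
  have carU X : F X -> car X `<=` car (\bigcup_(X in F) X).
    by move=> FX x [z Xz]; exists z, X.
  split.
  - move=> x y [z1 [X FX Xx]] [z2 [Y FY Yy]].
    have [XY|YX] := totF X Y FX FY.
      have [Y1 _ _] := FP Y FY.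
      have [| |z Yz] := Y1 x y; [by exists z1; apply: XY|by exists z2|].
      by exists z, Y.
    have [X1 _ _] := FP X FX.
    have [| |z Xz] := X1 x y; [by exists z1|by exists z2; apply: YX|].
    by exists z, X.
  - move=> x y z [X FX Xz]; have [_ X2 _] := FP X FX.
    by have [? ? ?] := X2 _ _ _ Xz; split; apply: (carU X).
  - move=> x y x' y' z [X FX Xz] [Y FY Yz].
    have [XY|YX] := totF X Y FX FY.
      by have [_ _ Y3] := FP Y FY; apply: Y3 Yz; apply: XY.
    by have [_ _ X3] := FP X FX; apply: (X3 _ _ _ _ z) => //; apply: YX.
have [G1 G2 G3] := PG.
have [q qG] : exists q : T -> T -> T, forall x y, car G x -> car G y -> G (x, y, q x y).
  have H (p : T * T) : exists z, car G p.1 -> car G p.2 -> G (p, z).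
    have [[c1 c2]|nc] := pselect (car G p.1 /\ car G p.2).
      by case: p c1 c2 => x y /= /G1 /[apply] -[z Gz]; exists z.
    by exists (e 0) => c1 c2; case: nc.
  have [q qG] := choice H; exists (fun x y => q (x, y)) => x y.
  exact: qG (x, y).
have carq x y : car G x -> car G y -> car G (q x y).
  by move=> cx cy; have [] := G2 _ _ _ (qG _ _ cx cy).
have injq x y x' y' : car G x -> car G y -> car G x' -> car G y' ->
    q x y = q x' y' -> x = x' /\ y = y'.
  move=> cx cy cx' cy' eq; apply: (G3 _ _ _ _ (q x y)); first exact: qG.
  by rewrite eq; apply: qG.
have ce n : car G (e n) by have [z Gz] := carG0 n; exists z; apply: G0G.
(* The elements e 0, e 1 and e 2 of Y label up to three disjoint copies of Y
   inside Y. *)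
pose q3 n x := q (e n) x.
have [|] := card_le_total {x | ~ car G x} {x | car G x}.
  move=> /card_leTP[f injf].
  pose k x := if pselect (car G x) is right nc then q3 0 (sval (f (exist _ x nc)))
              else q3 1 x.
  have ck x : car G (k x).
    by rewrite /k; case: pselect => c; apply: carq => //; apply: svalP.
  have injk : injective k.
    move=> x y; rewrite /k; case: pselect => cx; case: pselect => cy.
    - by move/injq => [].
    - by move/injq => [] //; [apply: svalP|move/inje].
    - by move/injq => [] //; [apply: svalP|move/inje].
    - move/injq => [] //; [exact: svalP|exact: svalP|].
      by move=> _ /eq_sig_hprop-/(_ (fun _ _ _ => Prop_irrelevance _ _))/injf[].
  apply/card_leTP; exists (fun p => q (k p.1) (k p.2)) => -[x y] [x' y'] /=.
  by move/injq => [] // /injk-> /injk->.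
move=> /card_leTP[f' injf'].
pose f x := if pselect (car G x) is left c then sval (f' (exist _ x c)) else x.
have cf x : car G x -> ~ car G (f x).
  by rewrite /f; case: pselect => // c _; exact: (svalP (f' _)).
have injf x y : car G x -> car G y -> f x = f y -> x = y.
  rewrite /f; case: pselect => // cx; case: pselect => // cy _ _.
  by move=> /eq_sig_hprop-/(_ (fun _ _ _ => Prop_irrelevance _ _))/injf'[].
pose H : set (T * T * T) := [set p | exists x y, car G x /\ car G y /\
  (p = (f x, y, f (q3 0 (q x y))) \/ p = (x, f y, f (q3 1 (q x y))) \/
   p = (f x, f y, f (q3 2 (q x y))))].
have carH z : car (G `|` H) z <-> car G z \/ exists2 x, car G x & z = f x.
  split=> [[u [Gz|Hz]]|[[u Gu]|[x cx ->]]].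
  - by left; exists u.
  - move: Hz => [x [y [cx [cy]]]].
    by move=> [[-> _ _]|[[-> _ _]|[-> _ _]]]; [right; exists x|left|right; exists x].
  - by exists u; left.
  - by exists (f (q3 2 (q x x))); right; exists x, x; split=> //; split=> //; right; right.
have cq n a b : car G a -> car G b -> car G (q3 n (q a b)).
  by move=> ca cb; apply: (carq) => //; apply: (carq).
have injfq m n a b a' b' : car G a -> car G b -> car G a' -> car G b' ->
    f (q3 m (q a b)) = f (q3 n (q a' b')) -> [/\ m = n, a = a' & b = b'].
  move=> ca cb ca' cb' /injf-/(_ (cq _ _ _ ca cb) (cq _ _ _ ca' cb')).
  by move=> /injq[] //; [exact: carq|exact: carq|move=> /inje-> /injq[]].
have HnG x y z : H (x, y, z) -> ~ car G z.
  by move=> [a [b [ca [cb [[_ _ ->]|[[_ _ ->]|[_ _ ->]]]]]]]; apply/cf/cq.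
case: (cf (e 0) (ce 0)); have [u Hu] : car (G `|` H) (f (e 0)).
  by apply/carH; right; exists (e 0).
exists u; apply: maxG Hu; first exact: subsetUl.
split.
- move=> x y /carH[cx|[x' cx' ->]] /carH[cy|[y' cy' ->]].
  + by have [z Gz] := G1 x y cx cy; exists z; left.
  + by exists (f (q3 1 (q x y'))); right; exists x, y'; do ![split=> //]; right; left.
  + by exists (f (q3 0 (q x' y))); right; exists x', y; do ![split=> //]; left.
  + by exists (f (q3 2 (q x' y'))); right; exists x', y'; do ![split=> //]; right; right.
- move=> x y z [/G2[? ? ?]|]; first by split; apply/carH; left.
  move=> [a [b [ca [cb [[-> -> ->]|[[-> -> ->]|[-> -> ->]]]]]]]; split;
    apply/carH; by [left|right; eexists; last by []; rewrite //; apply: cq].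
- move=> x y x' y' z [Gz|Hz] [Gz'|Hz'].
  + exact: G3 Gz Gz'.
  + by case: (HnG _ _ _ Hz'); have [] := G2 _ _ _ Gz.
  + by case: (HnG _ _ _ Hz); have [] := G2 _ _ _ Gz'.
  + move: Hz Hz' => [a [b [ca [cb ab]]]] [a' [b' [ca' [cb' ab']]]].
    by move: ab ab' => [[-> -> ->]|[[-> -> ->]|[-> -> ->]]]
      [[-> ->]|[[-> ->]|[-> ->]]] /injfq[] // _ -> ->.
Qed.

Lemma infinite_card_seq (T : Type) :
  [set: nat] #<= [set: T] -> [set: seq T] #<= [set: T].
Proof.
move=> leT; have /card_leTP[q injq] := infinite_card_square leT.
have /card_leTP[e inje] := leT.
pose code (s : seq T) := foldr (fun x y => q (x, y)) (e 0) s.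
apply/card_leTP; exists (fun s => q (e (size s), code s)).
move=> s t /injq[/inje]; elim: s t => [|x s IHs] [|y t] //= [st].
by move=> /injq[-> /(IHs t st)->].
Qed.

(** An algebra generated by countably many families of finitary operations with
    parameters in K has at most |K| + aleph_0 elements, because each of them is
    the value of a term, and terms are finite trees labelled by [nat] and K.
    Parameters are stored as leaves in front of the arguments of a node; their
    number is part of the label, since an argument may itself be a leaf. *)
Lemma closure_card_le (I : countType) (K P : Type)
    (op : I -> seq K -> seq P -> P) :
  exists X : set P, X #<= [set: K + nat] /\
    forall i ks xs, (forall n x0, (n < size xs)%N -> X (nth x0 xs n)) ->
    X (op i ks xs).
Proof.
have [[z _]|P0] := pselect (exists z : P, True); last first.
  exists setT; split=> //; rewrite (_ : setT = set0) //.
  by rewrite -subset0 => z _; apply: P0; exists z.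
pose lab (t : GenTree.tree K) := if t is GenTree.Leaf k then Some k else None.
pose eval := fix eval (t : GenTree.tree K) : P :=
  if t is GenTree.Node n ts then
    if unpickle n is Some (i, m) then
      op i (pmap lab (take m ts)) (drop m (map eval ts))
    else z
  else z.
exists (range eval); split.
  apply: card_le_trans (card_image_le _ _) _.
  have leK : [set: nat] #<= [set: K + nat] by apply/card_leTP; exists inr => x y [].
  apply: card_le_trans (infinite_card_seq leK).
  apply/card_leTP.
  exists (map (fun x : nat + K => if x is inr k then inl k
    else if x is inl n then inr n else inr 0%N) \o @GenTree.encode K).
  apply: inj_comp; last exact: pcan_inj (@GenTree.codeK K).
  by apply: inj_map => -[m|k] [n|k'] //= [->].
move=> i ks xs Xxs.
have [ts ->] : exists ts, xs = map eval ts.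
  elim: xs Xxs => [|x xs IHxs] Xxs; first by exists [::].
  have [|ts ->] := IHxs; first by move=> n; apply: (Xxs n.+1).
  by have [t _ /= <-] := Xxs 0%N x isT; exists (t :: ts).
exists (GenTree.Node (pickle (i, size ks)) (map (@GenTree.Leaf K) ks ++ ts)) => //=.
rewrite pickleK map_cat take_size_cat ?size_map // drop_size_cat ?size_map //.
by rewrite (map_pK (g := @GenTree.Leaf K)).
Qed.

Local Open Scope ring_scope.

(** * Matrices acting on columns of module elements *)

(** Systems of linear equations with coefficients in R and unknowns in E; the
    matrix product is not available because the two types of entries differ. *)
Definition mxact (R : pzRingType) (E : lmodType R) m n
    (A : 'M[R]_(m, n)) (x : 'cV[E]_n) : 'cV[E]_m :=
  \col_i \sum_j A i j *: x j 0.
Local Notation "A *v x" := (mxact A x) (at level 40, left associativity) : ring_scope.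

Section MatrixAction.
Context {R : pzRingType} {E : lmodType R}.
Implicit Types m n p : nat.

Lemma mxactA m n p (A : 'M[R]_(m, n)) (B : 'M[R]_(n, p)) (x : 'cV[E]_p) :
  A *v (B *v x) = A *m B *v x.
Proof.
apply/colP => i; rewrite !mxE.
under eq_bigr do rewrite mxE scaler_sumr.
rewrite exchange_big /=; apply: eq_bigr => k _.
by rewrite mxE scaler_suml; apply: eq_bigr => j _; rewrite scalerA.
Qed.

Lemma mxactBr m n (A : 'M[R]_(m, n)) (x y : 'cV[E]_n) :
  A *v (x - y) = A *v x - A *v y.
Proof.
apply/colP => i; rewrite !mxE -sumrB.
by apply: eq_bigr => j _; rewrite !mxE scalerBr.
Qed.

Lemma mxactDr m n (A : 'M[R]_(m, n)) (x y : 'cV[E]_n) :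
  A *v (x + y) = A *v x + A *v y.
Proof.
apply/colP => i; rewrite !mxE -big_split.
by apply: eq_bigr => j _; rewrite !mxE scalerDr.
Qed.

Lemma mxactBl m n (A B : 'M[R]_(m, n)) (x : 'cV[E]_n) :
  (A - B) *v x = A *v x - B *v x.
Proof.
apply/colP => i; rewrite !mxE -sumrB.
by apply: eq_bigr => j _; rewrite !mxE scalerBl.
Qed.

Lemma mxact0l m n (x : 'cV[E]_n) : (0 : 'M[R]_(m, n)) *v x = 0.
Proof. by apply/colP => i; rewrite !mxE big1 // => j _; rewrite mxE scale0r. Qed.

Lemma mxact0r m n (A : 'M[R]_(m, n)) : A *v (0 : 'cV[E]_n) = 0.
Proof. by apply/colP => i; rewrite !mxE big1 // => j _; rewrite mxE scaler0. Qed.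

Lemma mxact1 n (x : 'cV[E]_n) : 1%:M *v x = x.
Proof.
apply/colP => i; rewrite !mxE (bigD1 i) //= mxE eqxx scale1r big1 ?addr0 // => j.
by rewrite mxE eq_sym => /negPf->; rewrite scale0r.
Qed.

Lemma mxact_row_col m n p (A : 'M[R]_(m, n)) (B : 'M[R]_(m, p))
    (x : 'cV[E]_n) (y : 'cV[E]_p) :
  row_mx A B *v col_mx x y = A *v x + B *v y.
Proof.
apply/colP => i; rewrite !mxE big_split_ord /=.
by congr (_ + _); apply: eq_bigr => j _; rewrite !(row_mxEl, row_mxEr, col_mxEu, col_mxEd).
Qed.

Lemma mxact_col m n p (A : 'M[R]_(m, n)) (B : 'M[R]_(p, n)) (x : 'cV[E]_n) :
  col_mx A B *v x = col_mx (A *v x) (B *v x).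
Proof.
apply/colP => i; rewrite -[i]splitK; case: (fintype.split i) => k /=.
  by rewrite col_mxEu !mxE; apply: eq_bigr => j _; rewrite col_mxEu.
by rewrite col_mxEd !mxE; apply: eq_bigr => j _; rewrite col_mxEd.
Qed.

Lemma map_mxact (F : lmodType R) (f : {linear E -> F}) m n (A : 'M[R]_(m, n))
    (x : 'cV[E]_n) :
  map_mx f (A *v x) = A *v map_mx f x.
Proof.
apply/colP => i; rewrite !mxE linear_sum.
by apply: eq_bigr => j _; rewrite linearZ mxE.
Qed.

Lemma map_mx_linearB (F : lmodType R) (f : {linear E -> F}) m n (x y : 'M[E]_(m, n)) :
  map_mx f (x - y) = map_mx f x - map_mx f y.
Proof. by apply/matrixP => i j; rewrite !mxE linearB. Qed.

End MatrixAction.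

(** * Submodules as sets *)

Definition submod_set (R : pzRingType) (E : lmodType R) (S : set E) : Prop :=
  S 0 /\ forall (a : R) x y, S x -> S y -> S (a *: x + y).

Definition col_in (E : Type) (S : set E) n (x : 'cV[E]_n) : Prop :=
  forall i, S (x i 0).

Section SubmodSet.
Context {R : pzRingType} {E : lmodType R} (S : set E).
Hypothesis subS : submod_set S.

Lemma submod_setZ a x : S x -> S (a *: x).
Proof. by move=> Sx; rewrite -[_ *: _]addr0; apply: subS.2 => //; apply: subS.1. Qed.

Lemma submod_setD x y : S x -> S y -> S (x + y).
Proof. by move=> Sx Sy; rewrite -[x]scale1r; apply: subS.2. Qed.

Lemma submod_setN x : S x -> S (- x).
Proof. by rewrite -scaleN1r; apply: submod_setZ. Qed.

Lemma submod_setB x y : S x -> S y -> S (x - y).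
Proof. by move=> Sx /submod_setN; apply: submod_setD. Qed.

Lemma submod_set_sum n (x : 'I_n -> E) :
  (forall i, S (x i)) -> S (\sum_i x i).
Proof. by move=> Sx; elim/big_ind: _ => //; [apply: subS.1|apply: submod_setD]. Qed.

Lemma col_inD n (x y : 'cV[E]_n) : col_in S x -> col_in S y -> col_in S (x + y).
Proof. by move=> Sx Sy i; rewrite mxE; apply: submod_setD. Qed.

Lemma col_inN n (x : 'cV[E]_n) : col_in S x -> col_in S (- x).
Proof. by move=> Sx i; rewrite mxE; apply: submod_setN. Qed.

Lemma col_inB n (x y : 'cV[E]_n) : col_in S x -> col_in S y -> col_in S (x - y).
Proof. by move=> Sx Sy; apply: col_inD => //; apply: col_inN. Qed.

Lemma col_in_mxact m n (A : 'M[R]_(m, n)) (x : 'cV[E]_n) :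
  col_in S x -> col_in S (A *v x).
Proof. by move=> Sx i; rewrite mxE; apply: submod_set_sum => j; apply: submod_setZ. Qed.

Lemma submod_set_submodClosed : exists V : submodClosed E, [set` V] = S.
Proof.
pose V : {pred E} := [pred x | `[< S x >]].
have Vc : submod_closed V.
  split; first by apply/asboolP/subS.1.
  by move=> a x y /asboolP Sx /asboolP Sy; apply/asboolP/subS.2.
pose V' : submodClosed E := HB.pack (V : E -> bool) (GRing.isSubmodClosed.Build R E V Vc).
exists V'; apply/seteqP; split=> x; rewrite /= !inE //.
Qed.

End SubmodSet.

(** * Flat quotients and linear equations *)

Lemma col_in_col_mx (E : Type) (S : set E) m n (x : 'cV[E]_m) (y : 'cV[E]_n) :
  col_in S x -> col_in S y -> col_in S (col_mx x y).
Proof.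
move=> Sx Sy i; rewrite -[i]splitK; case: (fintype.split i) => k /=.
  by rewrite col_mxEu.
by rewrite col_mxEd.
Qed.

(** The equational criterion for flatness of (S + T) / S: a linear relation that
    elements of T satisfy modulo S is a consequence of relations in R.  In this
    form no quotient module is needed, and for fixed T the criterion passes to
    unions of chains of sets S. *)
Definition flat_quotient (R : pzRingType) (E : lmodType R) (S T : set E) : Prop :=
  forall n (r : 'rV[R]_n) (x : 'cV[E]_n), col_in T x -> col_in S (r *v x) ->
  exists m (a : 'M[R]_(n, m)) (y : 'cV[E]_m),
    [/\ col_in T y, col_in S (x - a *v y) & r *m a = 0].

Section FlatQuotient.
Context {R : pzRingType} {E : lmodType R} (S T : set E).
Hypotheses (subS : submod_set S) (ST : S `<=` T).
Hypothesis flatST : flat_quotient S T.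

(** The equations are solved one at a time: after the first, the unknowns are
    rewritten in terms of y, which has one equation fewer to satisfy. *)
Lemma flat_quotient_system k n (A : 'M[R]_(k, n)) (x : 'cV[E]_n) :
  col_in T x -> col_in S (A *v x) ->
  exists m (a : 'M[R]_(n, m)) (y : 'cV[E]_m),
    [/\ col_in T y, col_in S (x - a *v y) & A *m a = 0].
Proof.
elim: k n A x => [|k IHk]; rewrite -?[k.+1]/(1 + k)%N => n A x Tx SAx.
  exists n, 1%:M, x; rewrite mxact1 subrr flatmx0; split=> // i.
  by rewrite mxE; apply: subS.1.
rewrite -[A]vsubmxK in SAx *; move: (usubmx A) (dsubmx A) SAx => r B SAx.
have [|m [a [y [Ty Sy ra]]]] := flatST (r := r) Tx.
  by move=> i; have := SAx (lshift k i); rewrite mxact_col col_mxEu.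
have [|m' [a' [y' [Ty' Sy' ra']]]] := IHk _ (B *m a) y Ty.
  rewrite -mxactA -[a *v y](subKr x) mxactBr.
  apply: col_inB => //; last exact: col_in_mxact.
  by move=> i; have := SAx (rshift 1 i); rewrite mxact_col col_mxEd.
exists m', (a *m a'), y'; split=> //; last first.
  by rewrite mul_col_mx !mulmxA ra mul0mx ra' col_mx0.
rewrite -mxactA -(subrKA (a *v y)) -mxactBr.
by apply: col_inD => //; apply: col_in_mxact.
Qed.

(** If A x + B y = 0 with x in S, then B y is in S, so y = a z + s with B a = 0
    and s in S; hence s is a solution in S. *)
Lemma flat_quotient_pure : pure_sub S T.
Proof.
split=> // n phi x Sx [y Ty sat].
pose X : 'cV[E]_n := \col_i x i; pose Y : 'cV[E]_(pp_nbound phi) := \col_i y i.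
have satXY : pp_free phi *v X + pp_bound phi *v Y = 0.
  by apply/colP => i; rewrite !mxE -[RHS](sat i); congr (_ + _);
    apply: eq_bigr => j _; rewrite mxE.
have SX : col_in S X by move=> i; rewrite mxE.
have TY : col_in T Y by move=> i; rewrite mxE.
have SBY : col_in S (pp_bound phi *v Y).
  move/(canRL (addKr _)): satXY => ->; rewrite addr0; apply: col_inN => //.
  exact: col_in_mxact.
have [m [a [z [Tz Sz Ba]]]] := flat_quotient_system TY SBY.
exists (fun k => (Y - a *v z) k 0) => [k|i]; first exact: Sz.
have /colP/(_ i) : pp_free phi *v X + pp_bound phi *v (Y - a *v z) = 0.
  by rewrite mxactBr mxactA Ba mxact0l subr0.
rewrite !mxE => e; rewrite -[RHS]e; congr (_ + _).
by apply: eq_bigr => j _; rewrite mxE.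
Qed.
End FlatQuotient.

(** An extension of a flat module by a flat module is flat: a relation is first
    trivialized modulo S, and the remainders satisfy the same relation in S. *)
Lemma flat_extension (R : pzRingType) (E : lmodType R) (S : set E) :
  submod_set S -> flat_quotient [set 0 : E] S -> flat_quotient S setT ->
  flat_quotient [set 0 : E] setT.
Proof.
move=> subS flS flE n r x _ rx0.
have [//| |m [a [y [_ Sy ra]]]] := flE n r x.
  by move=> i; rewrite (rx0 i); apply: subS.1.
have [|m' [a' [y' [_ Sy' ra']]]] := flS n r (x - a *v y) Sy.
  by rewrite mxactBr mxactA ra mxact0l subr0.
exists (m + m')%N, (row_mx a a'), (col_mx y y'); split=> //.
  by rewrite mxact_row_col opprD addrA.
by rewrite mul_mx_row ra ra' row_mx0.
Qed.

Lemma flat_quotient_image (R : pzRingType) (E F : lmodType R) (g : {linear E -> F}) :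
  injective g -> flat_quotient [set 0 : E] setT -> flat_quotient [set 0 : F] (range g).
Proof.
move=> injg flE n r x gx rx0.
have [z zx] : exists z : 'cV[E]_n, x = map_mx g z.
  have /choice[z zP] : forall i, exists z, g z = x i 0.
    by move=> i; have [z _ ?] := gx i; exists z.
  by exists (\col_i z i); apply/colP => i; rewrite !mxE.
have [//|i /=|m [a [y [_ y0 ra]]]] := flE n r z.
  suff : g ((r *v z) i 0) = g 0 by move=> /injg.
  by rewrite linear0 -[RHS](rx0 i) zx -map_mxact [RHS]mxE.
exists m, a, (map_mx g y); split=> // [i|i /=]; first by rewrite mxE; exists (y i 0).
by rewrite zx -map_mxact -map_mx_linearB [LHS]mxE (y0 i : _ = 0) linear0.
Qed.

(** * Flatness implies the equational criterion *)

Lemma tensor_0r (R : pzRingType) (A : lmodType R^c) (M : lmodType R) (a : A) :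
  @tensor_eq R A M [:: (a, 0)] [::].
Proof.
apply: tensor_trans (tensor_0l A (0 : M)).
have := @tensor_balanced R A M 0 a 0; have -> : ((0 : R) : R^c) *: a = 0 by apply: scale0r.
by rewrite scale0r => /tensor_sym.
Qed.

Lemma tensor_1sum (R : pzRingType) (M : lmodType R) (I : Type) (e : seq I)
    (r : I -> R) (b : I -> (R^c)^o) (x : I -> M) :
  (forall i, b i = r i) ->
  tensor_eq [seq (b i, x i) | i <- e]
            [:: (1 : (R^c)^o, \sum_(i <- e) r i *: x i)].
Proof.
move=> br; elim: e => [|i e IHe] /=.
  by rewrite big_nil; apply/tensor_sym/tensor_0r.
rewrite big_cons; apply: tensor_trans (tensor_sym (tensor_Dr _ _ _)).
rewrite -cat1s -[X in tensor_eq _ X]cat1s; apply: tensor_cat IHe.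
apply: tensor_trans (tensor_balanced _ _ _); rewrite br.
rewrite (_ : (r i : R^c) *: (1 : (R^c)^o) = r i); first exact: tensor_refl.
by rewrite [LHS]/(_ * _) /= mul1r.
Qed.

Section FlatEquations.
Context {R : pzRingType} {M : lmodType R}.

(** The image in M^n of K (x) M, where K is the kernel of left multiplication by r
    on R^n.  The quotient of M^n by it is A (x) M, for A the right ideal generated
    by the entries of r. *)
Definition null_cols n (r : 'rV[R]_n) : set 'cV[M]_n :=
  [set x | exists m (a : 'M[R]_(n, m)) (y : 'cV[M]_m), x = a *v y /\ r *m a = 0].

Lemma null_cols0 n (r : 'rV[R]_n) : null_cols r 0.
Proof. by exists 0%N, 0, 0; rewrite mxact0l mulmx0. Qed.

Lemma null_colsD n (r : 'rV[R]_n) x y :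
  null_cols r x -> null_cols r y -> null_cols r (x + y).
Proof.
move=> [m [a [u [-> ra]]]] [p [b [v [-> rb]]]].
exists (m + p)%N, (row_mx a b), (col_mx u v).
by rewrite mxact_row_col mul_mx_row ra rb row_mx0.
Qed.

Lemma null_colsN n (r : 'rV[R]_n) x : null_cols r x -> null_cols r (- x).
Proof.
move=> [m [a [u [-> ra]]]]; exists m, a, (- u); split=> //.
by rewrite -[- u]sub0r mxactBr mxact0r sub0r.
Qed.

Lemma null_cols_scale n (r : 'rV[R]_n) (v : 'cV[R]_n) (x : M) :
  r *m v = 0 -> null_cols r (v *v const_mx x).
Proof. by move=> rv; exists 1%N, v, (const_mx x). Qed.

(** Tensor the inclusion of the right ideal A generated by the r_i into R with M.
    If the sum of the r_i x_i is 0, then so is the sum of the 1 (x) r_i x_i in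
    R (x) M, hence the sum of the r_i (x) x_i in A (x) M.  Choosing for each c in
    A a column v c with r v c = c gives a map Phi from A (x) M to M^n modulo
    [null_cols r], which sends the latter sum to x. *)
Lemma flat_equations : flat M -> flat_quotient [set 0 : M] setT.
Proof.
move=> flatM n r x _ rx0.
pose B : lmodType R^c := (R^c)^o.
pose S : set B := [set c | exists v : 'cV[R]_n, (r *m v) 0 0 = c :> R].
have subS : submod_set S.
  split; first by exists 0; rewrite mulmx0 mxE.
  move=> a _ _ [u <-] [v <-]; exists (\col_i (u i 0 * a) + v).
  rewrite mulmxDr !mxE; congr (_ + _).
  rewrite [RHS]/(_ *: _) /= [RHS]/(_ * _) /= mulr_suml.
  by apply: eq_bigr => i _; rewrite mxE mulrA.
have [V VS] := submod_set_submodClosed subS.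
have /choice[v vP] : forall c : submodule V, exists v : 'cV[R]_n, (r *m v) 0 0 = val c :> R.
  by move=> c; have : S (val c) by rewrite -VS; apply: valP.
have vV (c : submodule V) : r *m v c = (val c : R)%:M.
  by rewrite [LHS]mx11_scalar vP.
pose Phi (s : seq (submodule V * M)) := \sum_(p <- s) v p.1 *v const_mx p.2.
have PhiE s t : tensor_eq s t -> null_cols r (Phi s - Phi t).
  rewrite /Phi; elim=> {s t}.
  - by move=> s; rewrite subrr; apply: null_cols0.
  - by move=> s t _; rewrite -opprB => /null_colsN; rewrite opprK.
  - by move=> s t u _ st _ tu; rewrite -(subrKA (Phi t)); apply: null_colsD.
  - move=> s s' t t' _ ss' _ tt'; rewrite !big_cat opprD addrACA.
    exact: null_colsD.
  - move=> s t; rewrite !big_cat /= [X in X - _]addrC subrr.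
    exact: null_cols0.
  - move=> z; rewrite big_seq1 big_nil subr0; apply: null_cols_scale.
    by rewrite vV; apply/matrixP => i j; rewrite !mxE mul0rn.
  - move=> a b z; rewrite big_seq1 big_cons big_seq1 /= opprD addrA -!mxactBl.
    apply: null_cols_scale; rewrite !mulmxBr !vV.
    by rewrite -addrA -opprD -raddfD subrr.
  - move=> a z y; rewrite big_seq1 big_cons big_seq1 /= -mxactDr.
    rewrite (_ : const_mx (z + y) = const_mx z + const_mx y) ?subrr.
      exact: null_cols0.
    by apply/colP => i; rewrite !mxE.
  - move=> b a z; rewrite !big_seq1 /=.
    have -> : v a *v const_mx (b *: z) = (v a *m b%:M) *v const_mx z.
      rewrite -mxactA; congr (_ *v _); apply/colP => i.
      by rewrite !mxE big_ord1 !mxE ord1 eqxx.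
    rewrite -mxactBl; apply: null_cols_scale; rewrite mulmxBr mulmxA !vV.
    by rewrite -scalar_mxM subrr.
have /choice[c cP] : forall i, exists c : submodule V, val c = r 0 i :> B.
  move=> i; have ri : r 0 i \in V.
    suff: [set` V] (r 0 i) by [].
    by rewrite VS; exists (delta_mx i 0); rewrite -colE mxE.
  by exists (Submodule ri).
pose s := [seq (c i, x i 0) | i <- enum 'I_n].
pose f : {linear submodule V -> B} := val.
have : null_cols r (Phi s - Phi [::]).
  apply: PhiE; apply: (flatM _ _ f); first exact: val_inj.
  rewrite /tensor_map -map_comp /=.
  apply: tensor_trans (tensor_1sum _ _ _) _; first by move=> i; apply: cP.
  have -> : \sum_(i <- enum 'I_n) r 0 i *: x i 0 = 0.
    by rewrite big_enum /= -[RHS](rx0 0) mxE.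
  exact: tensor_0r.
rewrite /Phi big_nil subr0 /s big_map big_enum /= => nullPhi.
have [m [a [y [xa ra]]]] : null_cols r x; last first.
  by exists m, a, y; split=> // i; rewrite xa subrr mxE.
rewrite -[x](subrK (\sum_i v (c i) *v const_mx (x i 0))).
apply: null_colsD nullPhi.
have {1}-> : x = \sum_i (delta_mx i 0 : 'cV[R]_n) *v const_mx (x i 0).
  apply/colP => i; rewrite summxE (bigD1 i) //= big1 => [|j ji].
    by rewrite !mxE big_ord1 !mxE !eqxx scale1r addr0.
  by rewrite !mxE big_ord1 !mxE eq_sym (negPf ji) scale0r.
rewrite -sumrB; elim/big_ind: _ => [|u w|i _]; [exact: null_cols0|exact: null_colsD|].
rewrite -mxactBl; apply: null_cols_scale; rewrite mulmxBr vV cP.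
by apply/matrixP => j k; rewrite !ord1 -colE !mxE eqxx mulr1n subrr.
Qed.
End FlatEquations.

(** * The equational criterion implies flatness *)

Section EquationsFlat.
Context {R : pzRingType} {M : lmodType R}.
Hypothesis flM : flat_quotient [set 0 : M] setT.

Section Factor.
Context {B : lmodType R^c}.

(** The list s stands for an element of B (x) R^n; [realize y] is the effect of
    tensoring B with the map R^n -> M given by y, and [weight] is the isomorphism
    from B (x) R^n to B^n. *)
Definition realize n (y : 'cV[M]_n) (s : seq (B * 'rV[R]_n)) : seq (B * M) :=
  [seq (p.1, (p.2 *v y) 0 0) | p <- s].

Definition weight n (s : seq (B * 'rV[R]_n)) (j : 'I_n) : B :=
  \sum_(p <- s) (p.2 0 j : R^c) *: p.1.

Definition base_change m n (e : 'M[R]_(m, n)) (s : seq (B * 'rV[R]_m)) :=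
  [seq (p.1, p.2 *m e) | p <- s].

Lemma realize_base_change m n (e : 'M[R]_(m, n)) (y : 'cV[M]_n) s :
  realize y (base_change e s) = realize (e *v y) s.
Proof.
by rewrite /realize -map_comp; apply: eq_map => p /=; rewrite mxactA.
Qed.

Lemma weight_base_change m n (e : 'M[R]_(m, n)) s j :
  weight (base_change e s) j = \sum_i (e i j : R^c) *: weight s i.
Proof.
rewrite /weight big_map /=; under [RHS]eq_bigr do rewrite scaler_sumr.
rewrite exchange_big; apply: eq_bigr => p _ /=.
under [RHS]eq_bigr do rewrite scalerA.
by rewrite -scaler_suml mxE.
Qed.

(** M behaves like the directed colimit of the maps R^n -> M: two elements of
    B (x) M are equal when they come from the same element of some B (x) R^n. *)
Definition same_tensor (s t : seq (B * M)) : Prop :=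
  exists n (y : 'cV[M]_n) s' t',
    [/\ s = realize y s', t = realize y t' & weight s' =1 weight t'].

(** Any two lifts of the same list through y : R^n -> M become equal after y is
    factored through a suitable e : R^n -> R^m.  This is where the equational
    criterion enters: for each entry, the difference of the two lifts is a
    relation on y, to be trivialized. *)
Lemma realize_eq n (y : 'cV[M]_n) (s t : seq (B * 'rV[R]_n)) :
  realize y s = realize y t ->
  exists m (e : 'M[R]_(n, m)) (z : 'cV[M]_m),
    y = e *v z /\ base_change e s = base_change e t.
Proof.
have [k] := ubnP (size s); elim: k n y s t => // k IHk n y [|[b c] s] [|[b' c'] t] //=.
  by exists n, 1%:M, y; rewrite mxact1.
move=> ltk [<- cc' st].
have [//|i|m [e [z [_ z0 ce]]]] := flM (r := c - c') (x := y).
  suff : ((c - c') *v y) 0 0 = 0 by rewrite !ord1.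
  by rewrite mxactBl [LHS]mxE cc' [X in _ + X]mxE subrr.
have yz : y = e *v z.
  by apply/subr0_eq/colP => i; rewrite [RHS]mxE; apply: z0.
have [||p [f [w [zw ef]]]] := IHk _ z (base_change e s) (base_change e t).
- by rewrite size_map.
- by rewrite !realize_base_change -yz.
exists p, (e *m f), w; split; first by rewrite -mxactA -zw.
rewrite /base_change /= !mulmxA; congr ((_, _ *m f) :: _).
  by apply/eqP; rewrite -subr_eq0 -mulmxBl ce.
have bcM u : base_change (e *m f) u = base_change f (base_change e u).
  by rewrite /base_change -map_comp; apply: eq_map => q /=; rewrite mulmxA.
by have := ef; rewrite -!bcM.
Qed.

(** Both factorizations are first brought to the common column [col_mx y z]; the
    two lifts of t are then identified by [realize_eq]. *)
Lemma same_tensor_trans s t u :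
  same_tensor s t -> same_tensor t u -> same_tensor s u.
Proof.
move=> [m [y [s1 [t1 [-> -> w1]]]]] [n [z [t2 [u2 [tt -> w2]]]]].
pose e1 : 'M[R]_(m, m + n) := row_mx 1%:M 0.
pose e2 : 'M[R]_(n, m + n) := row_mx 0 1%:M.
have ye : y = e1 *v col_mx y z by rewrite mxact_row_col mxact1 mxact0l addr0.
have ze : z = e2 *v col_mx y z by rewrite mxact_row_col mxact1 mxact0l add0r.
have [|p [f [w [yzw tf]]]] := @realize_eq _ (col_mx y z) (base_change e1 t1) (base_change e2 t2).
  by rewrite !realize_base_change -ye -ze.
exists p, w, (base_change f (base_change e1 s1)), (base_change f (base_change e2 u2)).
rewrite !realize_base_change -yzw -ye -ze; split=> // j.
rewrite (weight_base_change f (base_change e1 s1)).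
under eq_bigr do (rewrite weight_base_change; under eq_bigr do rewrite w1).
under eq_bigr do rewrite -weight_base_change.
rewrite -weight_base_change tf !weight_base_change; apply: eq_bigr => i _.
by congr (_ *: _); rewrite !weight_base_change; apply: eq_bigr => k _; rewrite w2.
Qed.

Lemma same_tensor_cat s s' t t' :
  same_tensor s s' -> same_tensor t t' -> same_tensor (s ++ t) (s' ++ t').
Proof.
move=> [m [y [s1 [s1' [-> -> w1]]]]] [n [z [t2 [t2' [-> -> w2]]]]].
pose e1 : 'M[R]_(m, m + n) := row_mx 1%:M 0.
pose e2 : 'M[R]_(n, m + n) := row_mx 0 1%:M.
have ye : y = e1 *v col_mx y z by rewrite mxact_row_col mxact1 mxact0l addr0.
have ze : z = e2 *v col_mx y z by rewrite mxact_row_col mxact1 mxact0l add0r.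
exists (m + n)%N, (col_mx y z), (base_change e1 s1 ++ base_change e2 t2),
  (base_change e1 s1' ++ base_change e2 t2').
split; [| |move=> j].
- by rewrite [RHS]map_cat -!/(realize _ _) !realize_base_change -ye -ze.
- by rewrite [RHS]map_cat -!/(realize _ _) !realize_base_change -ye -ze.
- rewrite /weight !big_cat -!/(weight _ _) !weight_base_change.
  by congr (_ + _); apply: eq_bigr => i _; rewrite ?w1 ?w2.
Qed.

Lemma same_tensor_refl s : same_tensor s s.
Proof.
elim: s => [|[b x] s IHs]; first by exists 0%N, 0, [::], [::].
rewrite -cat1s; apply: same_tensor_cat IHs.
by exists 1%N, (const_mx x), [:: (b, 1%:M)], [:: (b, 1%:M)];
  rewrite /realize /= mxact1 mxE.
Qed.

Lemma tensor_eq_same s t : tensor_eq s t -> same_tensor s t.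
Proof.
elim=> {s t}.
- exact: same_tensor_refl.
- by move=> s t _ [n [y [s' [t' [? ? w]]]]]; exists n, y, t', s'; split.
- by move=> s t u _ st _ /(same_tensor_trans st).
- by move=> s s' t t' _ ss' _; apply: same_tensor_cat.
- move=> s t; have [n [y [u [_ [stu _ _]]]]] := same_tensor_refl (s ++ t).
  have us : s = realize y (take (size s) u).
    by rewrite /realize map_take -/(realize y u) -stu take_size_cat.
  have ut : t = realize y (drop (size s) u).
    by rewrite /realize map_drop -/(realize y u) -stu drop_size_cat.
  exists n, y, u, (drop (size s) u ++ take (size s) u); split=> [//||j].
    by rewrite /realize map_cat -!/(realize _ _) -us -ut.
  by rewrite -{1}[u](cat_take_drop (size s)) /weight !big_cat /= addrC.
- move=> x; exists 1%N, (const_mx x), [:: (0, 1%:M)], [::].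
  split=> //; first by rewrite /realize /= mxact1 mxE.
  by move=> j; rewrite /weight big_seq1 big_nil scaler0.
- move=> a b x.
  exists 1%N, (const_mx x), [:: (a + b, 1%:M)], [:: (a, 1%:M); (b, 1%:M)].
  split; rewrite /realize /= ?mxact1 ?mxE //.
  by move=> j; rewrite /weight big_seq1 big_cons big_seq1 scalerDr.
- move=> a x y; exists (1 + 1)%N, (col_mx (const_mx x : 'cV_1) (const_mx y : 'cV_1)).
  pose r0 : 'rV[R]_(1 + 1) := row_mx 1%:M 0; pose r1 : 'rV[R]_(1 + 1) := row_mx 0 1%:M.
  exists [:: (a, r0 + r1)], [:: (a, r0); (a, r1)].
  rewrite /r0 /r1; split.
  + rewrite add_row_mx addr0 add0r /realize /= mxact_row_col !mxact1.
    by rewrite !mxE.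
  + by rewrite /realize /= !mxact_row_col !mxact1 !mxact0l add0r addr0 !mxE.
  + move=> j; rewrite /weight big_seq1 big_cons big_seq1 -scalerDl /=.
    by rewrite [in LHS]mxE.
- move=> r a x; exists 1%N, (const_mx x), [:: ((r : R^c) *: a, 1%:M)], [:: (a, r%:M)].
  split; rewrite /realize /=; first by rewrite mxact1 mxE.
    by rewrite mxE big_ord1 !mxE eqxx.
  move=> j; rewrite /weight !big_seq1 /= scalerA !ord1 !mxE eqxx !mulr1n.
  by congr (_ *: _); apply: mul1r.
Qed.

Lemma tensor_pad n (y : 'cV[M]_n) (b c : 'I_n -> B) (e : seq 'I_n) :
  tensor_eq ([seq (b j, y j 0) | j <- e] ++ [seq (c j, y j 0) | j <- e])
            [seq (b j + c j, y j 0) | j <- e].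
Proof.
elim: e => [|j e IHe] /=; first exact: tensor_refl.
set s := [seq (b j, y j 0) | j <- e] in IHe *.
set t := [seq (c j, y j 0) | j <- e] in IHe *.
rewrite -cat1s -(cat1s (c j, y j 0)).
apply: (tensor_trans (t := ([:: (b j, y j 0)] ++ [:: (c j, y j 0)]) ++ (s ++ t))).
  rewrite -!catA; apply: tensor_cat; first exact: tensor_refl.
  rewrite !catA; apply: tensor_cat; last exact: tensor_refl.
  exact: tensor_catC.
rewrite -[X in tensor_eq _ X]cat1s; apply: tensor_cat => //.
exact/tensor_sym/tensor_Dl.
Qed.

Lemma tensor_realize n (y : 'cV[M]_n) s :
  tensor_eq (realize y s) [seq (weight s j, y j 0) | j <- enum 'I_n].
Proof.
elim: s => [|[b c] s IHs].
  rewrite /weight /=; elim: (enum _) => [|j e IHe] /=; first exact: tensor_refl.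
  rewrite big_nil -cat1s -[X in tensor_eq X _]cat0s; apply: tensor_cat => //.
  exact/tensor_sym/tensor_0l.
rewrite [realize _ _]/= -cat1s.
have -> : [seq (weight ((b, c) :: s) j, y j 0) | j <- enum 'I_n] =
    [seq ((c 0 j : R^c) *: b + weight s j, y j 0) | j <- enum 'I_n].
  by apply: eq_map => j; rewrite /weight big_cons.
apply: tensor_trans (tensor_pad _ _ _ _); apply: tensor_cat => //=.
rewrite mxE -[\sum_j _]big_enum /=.
elim: (enum _) => [|j e IHe] /=; first by rewrite big_nil; exact: tensor_0r.
rewrite big_cons; apply: tensor_trans (tensor_Dr _ _ _) _.
rewrite -cat1s -[X in tensor_eq _ X]cat1s; apply: tensor_cat => //.
exact/tensor_sym/tensor_balanced.
Qed.

End Factor.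

Lemma tensor_map_realize (A B : lmodType R^c) (f : {linear A -> B}) (s : seq (A * M))
    n (y : 'cV[M]_n) s' :
  tensor_map f s = realize y s' ->
  exists2 u, s = realize y u & s' = [seq (f p.1, p.2) | p <- u].
Proof.
elim: s s' => [|[a x] s IHs] [|[b c] s'] //=; first by exists [::].
by move=> [<- -> /IHs[u -> ->]]; exists ((a, c) :: u).
Qed.

(** Vanishing in B (x) M is witnessed by an equality of weights in B^n, which an
    injective map reflects. *)
Lemma equations_flat : flat M.
Proof.
move=> A B f injf s t /tensor_eq_same[n [y [s' [t' []]]]].
move=> /tensor_map_realize[u -> ->] /tensor_map_realize[w -> ->] uw.
apply: tensor_trans (tensor_realize _ _) _.
apply: tensor_trans (tensor_sym (tensor_realize _ _)).
have weight_map v j : weight [seq (f p.1, p.2) | p <- v] j = f (weight v j).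
  rewrite /weight big_map linear_sum; apply: eq_bigr => p _.
  by rewrite linearZ.
rewrite (_ : [seq (weight u j, _) | j <- _] = [seq (weight w j, y j 0) | j <- enum 'I_n]).
  exact: tensor_refl.
by apply: eq_map => j; congr (_, _); apply: injf; rewrite -!weight_map uw.
Qed.

End EquationsFlat.

(** * Quotient modules *)

Lemma linear_fun (R : pzRingType) (U V : lmodType R) (f : U -> V) :
  (forall a x y, f (a *: x + y) = a *: f x + f y) -> exists g : {linear U -> V}, g =1 f.
Proof.
move=> lf; pose g : {linear U -> V} := HB.pack f (GRing.isLinear.Build R U V *:%R f lf).
by exists g.
Qed.

Section QuotientModule.
Import Quotient.
Context {R : pzRingType} {V : lmodType R} (W : set V) (subW : submod_set W).
Local Open Scope quotient_scope.

Let inW : {pred V} := fun x => `[< W x >].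

Lemma submod_set_zmod_closed : zmod_closed inW.
Proof.
split; first by apply/asboolP/subW.1.
move=> x y /asboolP Wx /asboolP Wy; apply/asboolP.
exact: submod_setB.
Qed.

Definition submod_zmodClosed : zmodClosed V :=
  HB.pack (inW : V -> bool)
    (GRing.isZmodClosed.Build V inW submod_set_zmod_closed).
Local Notation quotW := (quot submod_zmodClosed).

Lemma submod_zmodClosedE x : x \in submod_zmodClosed = `[< W x >].
Proof. by []. Qed.

Definition quotient_module := quotW.
HB.instance Definition _ := GRing.Zmodule.on quotient_module.

Definition quotient_scale (a : R) : quotient_module -> quotient_module :=
  lift_op1 (quotW) ( *:%R a).

Lemma pi_scale a (x : V) :
  \pi_(quotW) (a *: x) = quotient_scale a (\pi_(quotW) x).
Proof.
rewrite /quotient_scale; unlock; apply/eqP; rewrite piE equivE.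
rewrite submod_zmodClosedE -scalerBr; apply/asboolP; apply: (submod_setZ subW).
by apply/asboolP; rewrite -[`[< _ >]]submod_zmodClosedE idealrBE reprK.
Qed.

Lemma quotient_scaleA a b (q : quotient_module) :
  quotient_scale a (quotient_scale b q) = quotient_scale (a * b) q.
Proof. by rewrite -[q]reprK -!pi_scale scalerA. Qed.

Lemma quotient_scale1 : left_id 1 quotient_scale.
Proof. by move=> q; rewrite -[q]reprK -pi_scale scale1r. Qed.

Lemma quotient_scaleDr : right_distributive quotient_scale +%R.
Proof.
move=> a q r; rewrite -[q]reprK -[r]reprK -!pi_scale -!pi_addr -pi_scale.
by rewrite scalerDr.
Qed.

Lemma quotient_scaleDl q : {morph quotient_scale^~ q : a b / a + b}.
Proof.
move=> a b; rewrite -[q]reprK -!pi_scale -!pi_addr.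
by rewrite scalerDl.
Qed.

HB.instance Definition _ := GRing.Zmodule_isLmodule.Build R quotient_module
  quotient_scaleA quotient_scale1 quotient_scaleDr quotient_scaleDl.

Lemma quotient_exists :
  exists (Q : lmodType R) (pi : {linear V -> Q}),
    (forall q, exists v, pi v = q) /\ forall x, pi x = 0 <-> W x.
Proof.
pose Q := quotient_module.
have [pi piE] : exists pi : {linear V -> Q}, pi =1 \pi_quotW.
  apply: linear_fun => a x y.
  by rewrite pi_addr pi_scale.
exists Q, pi; split=> [q|x].
  by exists (repr (q : quotW)); rewrite piE reprK.
have -> : W x = (x \in submod_zmodClosed).
  by rewrite submod_zmodClosedE asboolE.
rewrite piE -[x in x \in _]subr0 idealrBE pi_zeror.
by split=> /eqP.
Qed.

End QuotientModule.

(** * Small flat subquotients *)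

Lemma nth_enum_ord (T : Type) (x0 : T) n (f : 'I_n -> T) (i : 'I_n) :
  nth x0 [seq f j | j <- enum 'I_n] i = f i.
Proof. by rewrite (nth_map i) ?size_enum_ord // nth_ord_enum. Qed.

(** Every element of a flat module E / K lies in a small pure submodule of it.
    Here G is a small set of representatives of that submodule, obtained by closing
    p under linear combinations, under the solutions provided by the flatness of
    E / K, and under solving one linear equation modulo K. *)
Lemma small_flat_subquotient (R : pzRingType) (E : lmodType R) (K : set E) (p : E) :
  submod_set K -> flat_quotient K setT ->
  exists G : set E, [/\ G #<= [set: R + nat], submod_set G, G p,
    flat_quotient K G &
    forall n (r : 'rV[R]_n) (x : 'cV[E]_n) g, G g -> K ((r *v x) 0 0 - g) ->
      exists2 y : 'cV[E]_n, col_in G y & K ((r *v y) 0 0 - g)].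
Proof.
move=> subK flK.
(* Rows and columns are encoded by lists, the arguments of the operations under
   which G is to be closed. *)
pose rV n (ks : seq R) : 'rV[R]_n := \row_j nth 0 ks j.
pose cV n (xs : seq E) : 'cV[E]_n := \col_i nth 0 xs i.
have rVK n (r : 'rV[R]_n) : exists ks, r = rV n ks.
  exists [seq r 0 j | j <- enum 'I_n]; apply/rowP => j.
  by rewrite mxE nth_enum_ord.
have cVK n (x : 'cV[E]_n) : exists2 xs, x = cV n xs & size xs = n.
  exists [seq x j 0 | j <- enum 'I_n]; last by rewrite size_map size_enum_ord.
  by apply/colP => j; rewrite mxE nth_enum_ord.
(* sk1 and sk2 choose the solutions of the last two closure conditions. *)
have /choice[sk1 sk1P] : forall q : nat * seq R * seq E, exists ys : seq E,
    K ((rV q.1.1 q.1.2 *v cV q.1.1 q.2) 0 0) ->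
    exists m (a : 'M[R]_(q.1.1, m)),
      col_in K (cV q.1.1 q.2 - a *v cV m ys) /\ rV q.1.1 q.1.2 *m a = 0.
  move=> [[n ks] xs] /=.
  have [Kq|] := pselect (K ((rV n ks *v cV n xs) 0 0)); last by exists [::].
  have [//|i|m [a [y [_ Ky ra]]]] := flK n (rV n ks) (cV n xs); first by rewrite !ord1.
  by have [ys yE _] := cVK m y; exists ys => _; exists m, a; rewrite -yE.
have /choice[sk2 sk2P] : forall q : nat * seq R * E, exists ys : seq E,
    (exists x : 'cV[E]_q.1.1, K ((rV q.1.1 q.1.2 *v x) 0 0 - q.2)) ->
    K ((rV q.1.1 q.1.2 *v cV q.1.1 ys) 0 0 - q.2).
  move=> [[n ks] g] /=.
  have [[x Kx]|] := pselect (exists x : 'cV[E]_n, K ((rV n ks *v x) 0 0 - g)).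
    by have [ys yE _] := cVK n x; exists ys => _; rewrite -yE.
  by exists [::].
pose op (i : nat * nat * nat) ks xs := match i with
  | (0%N, _, _) => p
  | (1%N, n, _) => (rV n ks *v cV n xs) 0 0
  | (2%N, n, j) => nth 0 (sk1 (n, ks, xs)) j
  | (_, n, j) => nth 0 (sk2 (n, ks, nth 0 xs 0)) j
  end.
have [G [leG clG]] := closure_card_le op.
have Gp : G p by apply: (clG (0, 0, 0)%N [::] [::]).
have GcV n (x : 'cV[E]_n) : col_in G x ->
    exists xs, x = cV n xs /\ forall i x0, (i < size xs)%N -> G (nth x0 xs i).
  move=> Gx; have [xs xE sz] := cVK n x; exists xs; split=> // i x0 ltis.
  have lti : (i < n)%N by rewrite -sz.
  by have := Gx (Ordinal lti); rewrite xE mxE /= (set_nth_default x0).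
have Grow n (r : 'rV[R]_n) x : col_in G x -> G ((r *v x) 0 0).
  move=> /GcV[xs [-> Gxs]]; have [ks ->] := rVK n r.
  exact: (clG (1, n, 0)%N ks xs).
have GD a x y : G x -> G y -> G (a *: x + y).
  move=> Gx Gy.
  have -> : a *: x + y = (row_mx (a%:M : 'M_1) 1%:M *v
      col_mx (const_mx x : 'cV_1) (const_mx y)) 0 0.
    by rewrite mxact_row_col mxact1 !mxE big_ord1 !mxE.
  by apply: Grow; apply: col_in_col_mx => i; rewrite mxE.
exists G; split=> //.
- split=> //; rewrite -[0](subrr p) addrC -scaleN1r; exact: GD.
- move=> n r x /GcV[xs [-> Gxs]]; have [ks ->] := rVK n r => Krx.
  have [|m [a [Ka ra]]] := sk1P (n, ks, xs); first exact: Krx.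
  exists m, a, (cV m (sk1 (n, ks, xs))); split=> // i.
  by rewrite mxE; apply: (clG (2, n, nat_of_ord i)%N ks xs).
- move=> n r x g Gg Kg; have [ks rE] := rVK n r.
  exists (cV n (sk2 (n, ks, g))) => [i|].
    rewrite mxE; apply: (clG (3, n, nat_of_ord i)%N ks [:: g]).
    by case.
  by rewrite rE; apply: (sk2P (n, ks, g)); exists x; rewrite -rE.
Qed.

Definition sum_set (R : pzRingType) (E : lmodType R) (K G : set E) : set E :=
  [set z | exists k g, [/\ K k, G g & z = k + g]].

(** A solution of r x = g modulo K inside G turns x into x - y, which satisfies a
    relation modulo K; so a relation modulo K + G is trivialized modulo K + G. *)
Lemma flat_quotient_add (R : pzRingType) (E : lmodType R) (K G : set E) :
  submod_set K -> flat_quotient K setT ->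
  (forall n (r : 'rV[R]_n) (x : 'cV[E]_n) g, G g -> K ((r *v x) 0 0 - g) ->
     exists2 y : 'cV[E]_n, col_in G y & K ((r *v y) 0 0 - g)) ->
  flat_quotient (sum_set K G) setT.
Proof.
move=> subK flK solG n r x _ KGrx.
have [k [g [Kk Gg rxE]]] := KGrx 0.
have [|y Gy Kry] := solG n r x g Gg; first by rewrite rxE addrK.
have [//|i|m [a [z [_ Kz ra]]]] := flK n r (x - y).
  rewrite !ord1 mxactBr; have -> : (r *v x - r *v y) 0 0 = k - ((r *v y) 0 0 - g).
    by rewrite [LHS]mxE rxE [X in _ + X]mxE opprB addrA.
  exact: submod_setB.
exists m, a, z; split=> // i; exists ((x - y - a *v z) i 0), (y i 0); split=> //.
by rewrite !mxE addrAC subrK.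
Qed.

(** * Extending homomorphisms into an absorbing module *)

(** The property of limit models behind cotorsion: the values of a homomorphism on
    a small set lie in some C over which a pushout can be mapped back into M.  The
    lower bound on C makes room for pushouts with modules of size |X|. *)
Definition absorbing (R : pzRingType) (M : lmodType R) (X : Type) : Prop :=
  forall D : set M, D #<= [set: X] ->
  exists C C' : submodClosed M, [/\ D `<=` [set` C], flat (submodule C),
    [set: X] #<= [set: submodule C] & universal_over C C'].

Definition graph_dom (T U : Type) (G : set (T * U)) : set T := [set x | exists y, G (x, y)].

(** Partial homomorphisms are handled as their graphs, which are plain sets
    ordered by inclusion, so that unions of chains are directly available. *)
Definition hom_graph (R : pzRingType) (P M : lmodType R) (G : set (P * M)) : Prop :=
  submod_set G /\ forall m, G (0, m) -> m = 0.

Lemma submod_set_range (R : pzRingType) (U V : lmodType R) (g : {linear U -> V}) :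
  submod_set (range g).
Proof.
split; first by exists 0; rewrite ?raddf0.
by move=> a _ _ [x _ <-] [y _ <-]; exists (a *: x + y); rewrite ?linearP.
Qed.

Lemma pair0l_linear (R : pzRingType) (U V : lmodType R) (a : R) (x y : V) :
  (0 : U, a *: x + y) = a *: ((0 : U, x) : (U * V)%type) + (0, y).
Proof. by congr pair; rewrite /= scaler0 addr0. Qed.

Lemma pair0r_linear (R : pzRingType) (U V : lmodType R) (a : R) (x y : U) :
  (a *: x + y, 0 : V) = a *: ((x, 0 : V) : (U * V)%type) + (y, 0).
Proof. by congr pair; rewrite /= scaler0 addr0. Qed.

Section Extend.
Context {R : pzRingType} {P M : lmodType R}.
Hypothesis absM : absorbing M (R + nat).

Lemma submod_set_dom (G : set (P * M)) : submod_set G -> submod_set (graph_dom G).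
Proof.
move=> subG; split; first by exists 0; apply: subG.1.
by move=> a x y [u Gu] [v Gv]; exists (a *: u + v); apply: (subG.2 a _ _ Gu Gv).
Qed.

Lemma hom_graph_inj (G : set (P * M)) k m m' : hom_graph G ->
  G (k, m) -> G (k, m') -> m = m'.
Proof.
move=> [subG G0] Gm Gm'; apply/subr0_eq/G0.
have := submod_setB subG Gm Gm'.
by rewrite /GRing.add /= /add_pair /= subrr.
Qed.

(** The partial homomorphism h with graph G and domain K is extended to K + A,
    where A is a small submodule containing p with (K + A) / K and P / (K + A)
    flat.  The values of h on A meeting K lie in some C.  The pushout Q of A and C
    over that intersection is an extension of C by (K + A) / K, so it is flat and
    C is pure in it; being small, it embeds into C' over C by universality.  The
    composite A -> Q -> C' then agrees with h where both are defined. *)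
Lemma extend_hom_graph (G : set (P * M)) (p : P) :
  hom_graph G -> flat_quotient (graph_dom G) setT ->
  exists G' : set (P * M), [/\ hom_graph G', flat_quotient (graph_dom G') setT,
    G `<=` G' & graph_dom G' p].
Proof.
move=> homG flG; have [subG _] := homG; have subK := submod_set_dom subG.
have [A [leA subA Ap flA solA]] := small_flat_subquotient p subK flG.
pose D : set M := [set m | exists2 k, A k & G (k, m)].
have [C [C' [DC flatC leC univ]]] : exists C C' : submodClosed M,
    [/\ D `<=` [set` C], flat (submodule C),
        [set: R + nat] #<= [set: submodule C] & universal_over C C'].
  apply: absM; apply: card_le_trans leA.
  have /choice[h hP] : forall k, exists m, graph_dom G k -> G (k, m).
    move=> k; have [[m Gm]|] := pselect (graph_dom G k); first by exists m.
    by exists 0.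
  apply: card_le_trans (card_image_le h A); apply: subset_card_le.
  move=> m [k Ak Gm]; exists k => //.
  by apply: (hom_graph_inj homG (hP k _) Gm); exists m.
have [B BA] := submod_set_submodClosed subA.
have AB (k : submodule B) : A (val k) by rewrite -BA; apply: valP.
have BC (k : P) : A k -> k \in B by move=> Ak; have : [set` B] k by rewrite BA.
pose V : lmodType R := (submodule B * submodule C)%type.
(* Q is the quotient of A * C by the pairs (k, - h k). *)
pose W : set V := [set v | G (val v.1, - val v.2)].
have subW : submod_set W.
  split; first by rewrite /W /= oppr0; apply: subG.1.
  move=> a x y Wx Wy; rewrite /W /=.
  by have := subG.2 a _ _ Wx Wy; rewrite /= opprD -scalerN.
have [Q [pi [surj_pi kerW]]] := quotient_exists subW.
have [g gE] : exists g : {linear submodule C -> Q}, g =1 fun m => pi (0, m).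
  by apply: linear_fun => a x y; rewrite pair0l_linear linearP.
have piE u v : pi u = pi v <-> G (val u.1 - val v.1, val v.2 - val u.2).
  rewrite -[_ - val u.2]opprB.
  have -> : G (val u.1 - val v.1, - (val u.2 - val v.2)) = W (u - v).
    by rewrite /W /= !raddfB.
  by split=> [uv|/kerW uv]; [apply/kerW; rewrite linearB uv subrr|
    apply/subr0_eq; rewrite -linearB].
have AC k m : A k -> G (k, m) -> m \in C.
  by move=> Ak Gm; apply: (DC m); exists k.
have injg : injective g.
  move=> x y; rewrite !gE => /piE /=; rewrite subrr => /homG.2/subr0_eq.
  by move=> /val_inj->.
have subg := submod_set_range g.
have [p1 p1E] : exists p1 : {linear V -> P}, p1 =1 fun v => val v.1.
  by apply: linear_fun => a x y; apply: (linearP (val : {linear submodule B -> P})).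
(* The cokernel of g is (K + A) / K: a relation modulo the range of g projects
   by p1 to a relation modulo K in A. *)
have flg : flat_quotient (range g) setT.
  move=> n r x _ gx.
  have /choice[X XE] : forall i, exists v, pi v = x i 0 by move=> i; apply: surj_pi.
  have {XE} xE : x = map_mx pi (\col_i X i) by apply/colP => i; rewrite !mxE XE.
  move: (\col_i X i) xE => {}X xE.
  have AV m (Y : 'cV[V]_m) : col_in A (map_mx p1 Y).
    by move=> i; rewrite mxE p1E.
  have [|i|m [a [y [Ay Ky ra]]]] := flA n r (map_mx p1 X); first exact: AV.
    rewrite -map_mxact mxE p1E; have [c _ /esym] := gx i.
    rewrite xE -map_mxact mxE gE => /piE /=; rewrite raddf0 addr0 => Gc.
    by eexists; apply: Gc.
  have /choice[b bE] : forall j, exists b : submodule B, val b = y j 0.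
    by move=> j; exists (Submodule (BC _ (Ay j))).
  pose Y : 'cV[V]_m := \col_j (b j, 0).
  have yE : y = map_mx p1 Y by apply/colP => j; rewrite -bE [RHS]mxE p1E mxE.
  exists m, a, (map_mx pi Y); split=> // i.
  have := Ky i; rewrite yE -map_mxact -map_mx_linearB mxE p1E.
  rewrite xE -map_mxact -map_mx_linearB [in X in range g X]mxE.
  move: (_ i 0) => v [u Gu].
  pose c : submodule C := v.2 + Submodule (AC _ _ (AB _) Gu).
  exists c => //; rewrite gE; apply/esym/piE.
  by rewrite /c raddfD /= addrAC subrr add0r raddf0 addr0.
have flQ : flat Q.
  apply/equations_flat/(flat_extension subg) => //.
  exact/(flat_quotient_image injg)/flat_equations.
have leBC : [set: submodule B] #<= [set: submodule C].
  apply: card_le_trans leC; apply: card_le_trans leA.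
  have := @inj_card_eq _ _ [set: submodule B] val (in2W val_inj).
  rewrite card_eq_le => /andP[_ le]; apply: card_le_trans le _.
  by apply: subset_card_le => _ [k _ <-].
have leQ : [set: Q] #<= [set: submodule C].
  have infC : [set: nat] #<= [set: submodule C].
    by apply: card_le_trans leC; apply/card_leTP; exists inr => x y [].
  apply: card_le_trans (infinite_card_square infC).
  have /choice[s sE] := surj_pi; have /card_leTP[j injj] := leBC.
  apply/card_leTP; exists (fun q => (j (s q).1, (s q).2)) => q q' [/injj e1 e2].
  by rewrite -(sE q) -(sE q') (surjective_pairing (s q)) e1 e2 -surjective_pairing.
have pureg : pure_embedding g by split=> //; apply: flat_quotient_pure.
have [_ /(_ Q g flQ leQ pureg)[f _ fg]] := univ.
have [h hE] : exists h : {linear submodule B -> M},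
    h =1 fun u => val (f (pi (u, 0))).
  apply: linear_fun => a x y; rewrite pair0r_linear !linearP.
  exact: (linearP (val : {linear submodule C' -> M})).
have Gh k m u : G (k, m) -> k + val u = 0 -> m + h u = 0.
  move=> Gm /(canRL (addKr _)); rewrite addr0 => uk.
  have Guk : G (val u, - m) by rewrite uk; apply: (submod_setN subG Gm).
  rewrite hE; have -> : pi (u, 0) = g (Submodule (AC _ _ (AB u) Guk)).
    by rewrite gE; apply/piE; rewrite /= !raddf0 !addr0.
  by rewrite [\val _]fg /= subrr.
pose G' : set (P * M) := [set q | exists k m (u : submodule B),
  G (k, m) /\ q = (k + val u, m + h u)].
have domG' : graph_dom G' = sum_set (graph_dom G) A.
  apply/seteqP; split=> [_ [_ [k [m [u [Gm [-> _]]]]]]|_ [k [a [[m Gm] Aa ->]]]].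
    by exists k, (val u); split=> //; exists m.
  by exists (m + h (Submodule (BC _ Aa))), k, m, (Submodule (BC _ Aa)).
exists G'; split.
- split; last by move=> m' [k [m [u [Gm [/esym ku ->]]]]]; apply: Gh ku.
  split; first by exists 0, 0, 0; rewrite !raddf0 !addr0; split=> //; apply: subG.1.
  move=> a _ _ [k [m [u [Gm ->]]]] [l [n [v [Gn ->]]]].
  exists (a *: k + l), (a *: m + n), (a *: u + v); split.
    exact: (subG.2 a _ _ Gm Gn).
  congr pair; rewrite /= ?(linearP (val : {linear submodule B -> P})) ?linearP.
    by rewrite scalerDr addrACA.
  by rewrite scalerDr addrACA.
- by rewrite domG'; apply: flat_quotient_add.
- by move=> [k m] Gm; exists k, m, 0; rewrite !raddf0 !addr0.
- by rewrite domG'; exists 0, p; rewrite add0r; split=> //; apply: subK.1.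
Qed.
End Extend.

(** By Zorn's lemma there is a maximal partial homomorphism whose domain has a
    flat cokernel; [extend_hom_graph] makes its domain everything. *)
Lemma extend_linear (R : pzRingType) (P M : lmodType R) (G : set (P * M)) :
  absorbing M (R + nat) -> hom_graph G -> flat_quotient (graph_dom G) setT ->
  exists g : {linear P -> M}, forall x m, G (x, m) -> g x = m.
Proof.
move=> absM homG flG.
pose Z (H : set (P * M)) := hom_graph H /\ flat_quotient (graph_dom H) setT.
have [//|F FG FZ totF|H [GH [homH flH] maxH]] := @Zorn_bigcup_above _ Z G.
  split; last first.
    move=> n r x _ Krx; have [m [X FX Xm]] := Krx 0.
    have [_ flX] := FZ X FX; have [//|i|p [a [y [_ Ky ra]]]] := flX n r x.
      by rewrite ord1; exists m.
    by exists p, a, y; split=> // i; have [u Xu] := Ky i; exists u, X.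
  split; last by move=> m [X /FZ[[_ X0] _] /X0].
  split; first by exists G => //; apply: homG.1.1.
  move=> a u v [X FX Xu] [Y FY Yv].
  have [XY|YX] := totF X Y FX FY.
    by exists Y => //; have [[[_ cl] _] _] := FZ Y FY; apply: cl => //; apply: XY.
  by exists X => //; have [[[_ cl] _] _] := FZ X FX; apply: cl => //; apply: YX.
have /choice[h hP] : forall x, exists m, H (x, m).
  move=> x; have [H' [homH' flH' HH' [m H'm]]] := extend_hom_graph absM x homH flH.
  by exists m; apply: (maxH H').
have [g gE] : exists g : {linear P -> M}, g =1 h.
  apply: linear_fun => a x y; apply: (hom_graph_inj homH (hP _)).
  exact: (homH.1.2 a _ _ (hP x) (hP y)).
by exists g => x m Gm; rewrite gE; apply: (hom_graph_inj homH (hP x)); apply: GH.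
Qed.

(** A cocycle on the resolution P of F factors through the kernel K of
    P_0 -> F, and P_0 / K is F, which is flat; extending the resulting map from K
    to P_0 makes the cocycle a coboundary. *)
Lemma absorbing_cotorsion (R : pzRingType) (M : lmodType R) :
  absorbing M (R + nat) -> cotorsion M.
Proof.
move=> absM F /flat_equations flF res f f0.
pose G : set (res_mod res 0 * M) := [set q | exists x, q = (res_d res 0 x, f x)].
have [||g gG] := @extend_linear _ _ _ G absM.
- split; [split|].
  + by exists 0; rewrite !raddf0.
  + by move=> a _ _ [x ->] [y ->]; exists (a *: x + y); rewrite !linearP.
  + move=> m [x [/esym dx0 ->]].
    have : range (res_d res 1) x by rewrite (res_exactS res 0).
    by move=> [y _ <-].
- have domG z : graph_dom G z <-> res_aug res z = 0.
    have -> : (res_aug res z = 0) = [set x | res_aug res x = 0] z by [].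
    rewrite -(res_exact0 res); split=> [[m [x [-> _]]]|[x _ <-]]; first by exists x.
    by exists (f x), x.
  move=> n r x _ /(_ 0)/domG rx0.
  have [//|i|m [a [y [_ y0 ra]]]] := flF n r (map_mx (res_aug res) x).
    by rewrite ord1 -map_mxact; rewrite [X in [set 0] X]mxE.
  have /choice[z zE] : forall j, exists z, res_aug res z = y j 0.
    by move=> j; have [z _ ?] : range (res_aug res) (y j 0);
      [rewrite (res_surj res)|exists z].
  exists m, a, (\col_j z j); split=> // i; apply/domG.
  have := y0 i; rewrite (_ : y = map_mx (res_aug res) (\col_j z j)).
    by rewrite -map_mxact -map_mx_linearB [X in [set 0] X]mxE.
  by apply/colP => j; rewrite !mxE zE.
by exists g => x; rewrite (gG _ (f x)) //; exists x.
Qed.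

(** * Limit models *)

Lemma succ_exists (d : Order.disp_t) (alpha : orderType d) (i : alpha) :
  limit_ordinal alpha -> exists j, is_succ i j.
Proof.
move=> [wo _ /(_ i) [k ik]].
have [|j [[ij minj] _]] := wo [pred j | (i < j)%O]; first by exists k.
by exists j; split=> // l il; apply: minj.
Qed.

(** The indices at which at most |R| + aleph_0 elements of M appear in the chain
    are too few to be cofinal in alpha, so some C i contains all these elements. *)
Lemma limit_absorbing (R : pzRingType) (lambda kappa c : cardinal)
    (d : Order.disp_t) (alpha : orderType d) (M : lmodType R) :
  card_succ (R + nat)%type kappa -> [set: kappa] #<= [set: lambda] ->
  limit_model lambda alpha M -> cofinality alpha c -> [set: kappa] #<= [set: c] ->
  absorbing M (R + nat).
Proof.
move=> [[leRk nleRk] _] lekl [_ limalpha _ [C [flC mono _ univ covC]]] [_ cof] lekc D leD.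
have /choice[idx idxP] : forall m, exists i, m \in C i.
  move=> m; have [i _ Cm] : (\bigcup_i [set` C i]) m by rewrite covC.
  by exists i.
have /existsNP[i ncof] : ~ cofinal (idx @` D).
  move=> /cof lec; apply: nleRk; apply: card_le_trans lekc _.
  exact: card_le_trans lec (card_le_trans (card_image_le _ _) leD).
have [j ij] := succ_exists i limalpha.
exists (C i), (C j); split; last exact: univ.
- move=> m Dm; have lti : (idx m < i)%O.
    by rewrite ltNge; apply/negP => ii; apply: ncof; exists (idx m) => //; exists m.
  by apply: (mono _ _ lti).1; apply: idxP.
- exact: (flC i).1.
- have := (flC i).2; rewrite card_eq_le => /andP[_ le].
  by apply: card_le_trans le; apply: card_le_trans lekl.
Qed.

Theorem theorem3p5 (R : pzRingType) (lambda kappa c : cardinal)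
    (d : Order.disp_t) (alpha : orderType d) (M : lmodType R)
    (hkappa : card_succ (R + nat)%type kappa)
    (hlambda : [set: kappa] #<= [set: lambda])
    (hM : limit_model lambda alpha M)
    (hc : cofinality alpha c)
    (hcf : [set: kappa] #<= [set: c]) :
  cotorsion M.
Proof.
exact: absorbing_cotorsion (limit_absorbing hkappa hlambda hM hc hcf).
Qed.
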